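(* Let $\sigma$ be a permutation of length $m$ with $r$ descents and $\pi$ a permutation of length $n$ with $s$ descents, where $\sigma$ and $\pi$ have no letters in common, and let $k\ge 0$ be an integer. Let $S_k(\sigma,\pi)$ be the set of all shuffles of $\sigma$ and $\pi$ with exactly $k$ descents. Then there is a bijection $\Phi: S_k(\sigma,\pi)\to P_{k-r}(k-s,m)\times P_{\le n-k+r}(k-s)$ such that for every $\alpha\in S_k(\sigma,\pi)$, writing $(\lambda,\mu)=\Phi(\alpha)$, \[{\rm maj}(\alpha)=|\lambda|+|\mu|+{\rm maj}(\sigma)+{\rm maj}(\pi).\]
   Context: A permutation of length $n$ is a sequence of $n$ distinct letters from a totally ordered set (not necessarily $1,\dots,n$). An index $i$ is a descent of $\pi=\pi_1\cdots\pi_n$ if $1\le i\le n-1$ and $\pi_i>\pi_{i+1}$; ${\rm des}(\pi)$ is the number of descents and ${\rm maj}(\pi)$ is the sum of the descents. A shuffle of disjoint permutations $\sigma$ and $\pi$ is a permutation of length $m+n$ containing both $\sigma$ and $\pi$ as subsequences. For integers $j,t,N$: $P_j(t,N)$ is the set of nonincreasing integer sequences $\lambda=(\lambda_1\ge\cdots\ge\lambda_j)$ of length exactly $j$ with $\lambda_1\le N$ and $\lambda_j\ge t$; $P_{\le j}(N)$ is the set of partitions with at most $j$ parts and largest part at most $N$ (equivalently, nonincreasing sequences of length $j$ with entries in $\{0,\dots,N\}$). $|\lambda|$ denotes the sum of the entries. By convention these sets are empty whenever $j<0$ or a required bound is negative (so both sides are empty when $k$ is outside the possible range). *)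

(* Defs.v *)
From HB Require Import structures.
From mathcomp Require Import all_boot all_order all_algebra.

Set Implicit Arguments.
Unset Strict Implicit.
Unset Printing Implicit Defensive.

Import Order.TTheory GRing.Theory Num.Theory.

Local Open Scope ring_scope.

Section Permutations.

Context (d : Order.disp_t) (T : orderType d).
Implicit Types (sigma pi alpha : seq T).

(* A permutation is a duplicate-free sequence of letters.  Descents are       *)
(* 1-based positions, whereas onth is 0-based.                                *)
Definition is_descent alpha (i : nat) : bool :=
  (1 <= i <= (size alpha).-1)%N &&
  (if (onth alpha i.-1, onth alpha i) is (Some x, Some y)
   then (y < x)%O else false).

Definition descents alpha : seq nat :=
  [seq i <- iota 1 (size alpha).-1 | is_descent alpha i].

Definition des alpha : nat := size (descents alpha).

Definition maj alpha : nat := sumn (descents alpha).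

Definition is_shuffle sigma pi alpha : bool :=
  [&& uniq alpha, size alpha == (size sigma + size pi)%N,
      subseq sigma alpha & subseq pi alpha].

Definition shuffle_des (k : nat) sigma pi : Type :=
  {alpha : seq T | is_shuffle sigma pi alpha && (des alpha == k)}.

End Permutations.

(* P_j(t, N).  The defaults of head and last make the bounds on the first and *)
(* last entries vacuous for the empty sequence; the first three conditions    *)
(* are the convention that the set is empty for negative j, t or N.           *)
Definition in_P (j t N : int) (la : seq int) : bool :=
  [&& 0 <= j, 0 <= t, 0 <= N, (size la)%:Z == j, sorted >=%R la,
      head N la <= N & t <= last t la].

Definition P (j t N : int) : Type := {la : seq int | in_P j t N la}.

(* P_{<= j}(N).  A partition is the nonincreasing sequence of its (positive)  *)
(* parts, so that the zero partition is the empty sequence.                   *)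
Definition is_partition (mu : seq int) : bool :=
  sorted >=%R mu && all (fun x => 0 < x) mu.

Definition in_Ple (j N : int) (mu : seq int) : bool :=
  [&& 0 <= j, 0 <= N, is_partition mu, (size mu)%:Z <= j & head 0 mu <= N].

Definition Ple (j N : int) : Type := {mu : seq int | in_Ple j N mu}.

Definition weight (la : seq int) : int := \sum_(x <- la) x.

(* Main.v *)
Require Import Defs.
From HB Require Import structures.
From mathcomp Require Import all_boot all_order all_algebra.
From mathcomp Require Import zify ring.

Set Implicit Arguments.
Unset Strict Implicit.
Unset Printing Implicit Defensive.

Import Order.TTheory GRing.Theory Num.Theory.

Local Open Scope ring_scope.

(** Both sides are finite, so a maj-preserving bijection exists as soon as the
    generating functions agree. Let the last letter [a] of [sigma] be larger
    than the last letter [b] of [pi], and split the shuffles with [k] descents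
    according to their last letter. Each part has a product formula: with
    [m], [n] the two lengths and [e] the sum of the two major indices,

      ending with [a]: q^(e + (k-r)(k-s)) [m-r+s-1, k-r] [n-s+r, k-s],
      ending with [b]: q^(e + m + (k-r-1)(k-s)) [m-r+s-1, k-r-1] [n-s+r, k-s].

    Removing the last letter proves the two formulas simultaneously by
    induction on [m + n], each case being an instance of the Pascal rule
    [M+1, j+1] = [M, j+1] + q^(M-j) [M, j]; their sum is the generating
    function q^(e + (k-r)(k-s)) [m-r+s, k-r] [n-s+r, k-s] of the pairs of
    partitions. Words are handled in reverse, so that their last letter is the
    head of a list. *)

(** * Gaussian binomials *)

(** Here ['X] plays the role of $q$. Truncation in [M' - j'] is harmless, since [qbin M' j']
    vanishes when [M' < j']. *)
Fixpoint qbin (M j : nat) : {poly int} :=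
  match M, j with
  | _, 0 => 1
  | 0, _.+1 => 0
  | M'.+1, j'.+1 => qbin M' j + 'X^(M' - j') * qbin M' j'
  end.

Lemma qbin0 M : qbin M 0 = 1. Proof. by case: M. Qed.

Lemma qbin_rec M j :
  qbin M.+1 j.+1 = qbin M j.+1 + 'X^(M - j) * qbin M j.
Proof. by []. Qed.

Lemma qbin_small M j : (M < j)%N -> qbin M j = 0.
Proof.
elim: M j => [|M IH] [|j] //= lt_Mj.
by rewrite !IH ?(ltnW lt_Mj) // mulr0 addr0.
Qed.

Lemma qbinn M : qbin M M = 1.
Proof. by elim: M => //= M IH; rewrite qbin_small // IH subnn add0r mulr1. Qed.

(** The mirror Pascal rule, with the power of $q$ on the other term, as needed in [Plelist_gf].
    Expanding both sides reduces it to the exponent identity [e]. *)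
Lemma qbinS M j : qbin M.+1 j.+1 = 'X^(j.+1) * qbin M j.+1 + qbin M j.
Proof.
elim: M j => [|M IH] j.
  by case: j => [|j] /=; rewrite ?mulr0 ?mulr1 // add0r.
(* For [M < j] every binomial involved is 0 or 1; truncated subtraction would break the exponent
   identity used below. *)
have [lt_Mj|le_jM] := ltnP M j.
  have [->|lt_Mj'] : j = M.+1 \/ (M.+1 < j)%N by lia.
    by rewrite !qbinn qbin_small // mulr0 add0r.
  by rewrite !qbin_small ?mulr0 ?addr0 //; lia.
rewrite [LHS]qbin_rec {1}IH qbin_rec.
case: j le_jM => [|j] le_jM.
  by rewrite !qbin0 !subn0 !exprS expr0 !mulr1 mulrDr addrAC.
rewrite {1}IH qbin_rec.
have -> : (M.+1 - j.+1 = M - j)%N by lia.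
have e : 'X^(M - j) * 'X^(j.+1) = 'X^(j.+2) * 'X^(M - j.+1) :> {poly int}.
  by rewrite -!exprD; congr ('X^_); lia.
rewrite !mulrDr !mulrA -e; ring.
Qed.

(* [qbinl M k r] is the Gaussian binomial of [M] and the integer [k - r], which *)
(* vanishes when [k - r] is negative. *)
Definition qbinl (M k r : nat) : {poly int} :=
  if (r <= k)%N then qbin M (k - r) else 0.

Lemma qbinl_eq0 M k r : ~~ (r <= k <= M + r)%N -> qbinl M k r = 0.
Proof.
rewrite /qbinl; case: leqP => //= le_rk; rewrite -ltnNge => lt_k.
by apply: qbin_small; lia.
Qed.

Lemma qbinlSS M k r : qbinl M k.+1 r.+1 = qbinl M k r.
Proof. by rewrite /qbinl ltnS subSS. Qed.

(** Pascal's rule with [r.+1] instead of a smaller index, so that no case on the sign of [k - r]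
    arises in its uses and [qbinlSS] can lower [k] instead. *)
Lemma qbinlS M k r :
  qbinl M.+1 k r = qbinl M k r + 'X^(M.+1 - (k - r)) * qbinl M k r.+1.
Proof.
rewrite /qbinl; case: (ltngtP r k) => [lt_rk|_|->]; last 2 first.
- by rewrite mulr0 addr0.
- by rewrite subnn !qbin0 mulr0 addr0.
by have -> : (k - r = (k - r.+1).+1)%N by lia.
Qed.

(** Exponents containing truncated subtractions are compared only in the range outside which the
    binomial vanishes. *)
Lemma eq_Xqbinl e1 e2 M k r : ((r <= k <= M + r)%N -> e1 = e2) ->
  'X^e1 * qbinl M k r = 'X^e2 * qbinl M k r.
Proof.
case: (boolP (r <= k <= M + r)%N) => [_ ->//|/qbinl_eq0-> _].
by rewrite !mulr0.
Qed.

Lemma eq_Xqbinl2 e1 e2 M r N s k :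
  ((r <= k <= M + r)%N -> (s <= k <= N + s)%N -> e1 = e2) ->
  'X^e1 * qbinl M k r * qbinl N k s = 'X^e2 * qbinl M k r * qbinl N k s.
Proof.
case: (boolP (s <= k <= N + s)%N) => [sk|/qbinl_eq0-> _]; last by rewrite !mulr0.
by move=> e12; congr (_ * _); apply: eq_Xqbinl => rk; apply: e12.
Qed.

(* In a pair of words of lengths [m.+1] and [n.+1] with [r] and [s] descents, *)
(* the last letter of the first one being the larger, [gfA] and [gfB] are the *)
(* generating functions of the shuffles with [k] descents that end with the   *)
(* last letter of the first, respectively second, word; [e] is the sum of the *)
(* two major indices. [gf] counts all shuffles of words of lengths [m], [n].  *)
Definition gf m r n s e k : {poly int} :=
  'X^(e + (k - r) * (k - s)) * qbinl (m - r + s) k r * qbinl (n - s + r) k s.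

Definition gfA m r n s e k : {poly int} :=
  'X^(e + (k - r) * (k - s)) * qbinl (m - r + s) k r * qbinl (n - s + r).+1 k s.

Definition gfB m r n s e k : {poly int} :=
  'X^(e + m.+1 + (k - r.+1) * (k - s)) * qbinl (m - r + s) k r.+1 *
  qbinl (n - s + r).+1 k s.

(** * Recurrences of the product formulas *)

Lemma gfC m r n s e k : gf m r n s e k = gf n s m r e k.
Proof. by rewrite /gf [((k - r) * _)%N]mulnC mulrAC. Qed.

(** Pascal's rule on the first binomial: its power of $q$ has exponent $(m-r+s+1)-(k-r) =
    m+1-(k-s)$, which turns $(k-r)(k-s)$ into $m+1+(k-r-1)(k-s)$. *)
Lemma gf_split m r n s e k : (r <= m)%N -> (s <= n)%N ->
  gf m.+1 r n.+1 s e k = gfA m r n s e k + gfB m r n s e k.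
Proof.
move=> le_rm le_sn; rewrite /gf /gfA /gfB.
have -> : (m.+1 - r + s = (m - r + s).+1)%N by lia.
have -> : (n.+1 - s + r = (n - s + r).+1)%N by lia.
rewrite qbinlS mulrDr mulrDl; congr (_ + _); rewrite mulrA -exprD.
apply: eq_Xqbinl2 => rk sk.
have -> : (k - r = (k - r.+1).+1)%N by lia.
rewrite mulSn; lia.
Qed.

(** For a first word not ending with a descent: its last letter extends every shuffle of the
    shortened pair without a new descent. *)
Lemma gfA_asc m r n s e k : (s <= n)%N -> gfA m r n s e k = gf m r n.+1 s e k.
Proof. by move=> le_sn; rewrite /gf subSn. Qed.

(** For a first word ending with a descent, at position $m+1$: its last letter creates a descent, at
    position $m+n+2$, exactly after the shuffles ending with its preceding letter. *)
Lemma gfA_desc m r n s e k : (r <= m)%N -> (s <= n)%N ->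
  gfA m.+1 r.+1 n s (m.+1 + e) k =
  (if k is k'.+1 then 'X^((m + n).+2) * gfA m r n s e k' else 0) + gfB m r n s e k.
Proof.
move=> le_rm le_sn; rewrite /gfA /gfB subSS addnS [in LHS]qbinlS mulrDr addrC.
congr (_ + _); last by rewrite [(e + _)%N]addnC.
rewrite mulrA [_ * 'X^_]mulrAC -exprD.
case: k => [|k]; first by rewrite /qbinl mulr0.
rewrite !mulrA -exprD !qbinlSS !subSS; apply: eq_Xqbinl2 => rk sk.
rewrite subSn; last lia.
rewrite mulnS; lia.
Qed.

(** For a second word ending with a descent: both possible preceding letters exceed its last one,
    whichever of them is larger, so the symmetric [gf] appears. *)
Lemma gfB_desc m r n s e k : (r <= m)%N -> (s <= n)%N ->
  gfB m r n.+1 s.+1 (n.+1 + e) k =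
  (if k is k'.+1 then 'X^((m + n).+2) * gf m.+1 r n.+1 s e k' else 0).
Proof.
move=> le_rm le_sn; rewrite /gfB /gf subSS.
case: k => [|k]; first by rewrite /qbinl !(mulr0, mul0r).
have -> : (m.+1 - r + s = m - r + s.+1)%N by lia.
have -> : (n.+1 - s + r = (n - s + r).+1)%N by lia.
rewrite !mulrA -exprD !qbinlSS !subSS; apply: eq_Xqbinl2 => rk sk; lia.
Qed.

(** For a second word not ending with a descent: a new descent arises only after the last letter of
    the first word. *)
Lemma gfB_asc m r n s e k : (r <= m)%N -> (s <= n)%N ->
  gfB m r n.+1 s e k =
  (if k is k'.+1 then 'X^((m + n).+2) * gfA m r n s e k' else 0) + gfB m r n s e k.
Proof.
move=> le_rm le_sn; rewrite /gfA /gfB.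
have -> : (n.+1 - s + r = (n - s + r).+1)%N by lia.
rewrite [in LHS]qbinlS mulrDr addrC.
congr (_ + _); rewrite mulrA [_ * 'X^_]mulrAC -exprD.
case: k => [|k]; first by rewrite /qbinl !(mulr0, mul0r).
rewrite !mulrA -exprD !qbinlSS !subSS; apply: eq_Xqbinl2 => rk sk.
rewrite subSn; last lia.
rewrite mulnS; lia.
Qed.

(** * Shuffles of reversed words *)

Section Shuffles.
Context (d : Order.disp_t) (T : orderType d).
Implicit Types (u v w : seq T) (a b c : T) (L : seq (seq T)).

Fixpoint shuf u :=
  if u is a :: u' then
    fix shuf_u v := if v is b :: v' then
      [seq a :: w | w <- shuf u' v] ++ [seq b :: w | w <- shuf_u v'] else [:: u]
  else fun v => [:: v].

Lemma shuf_cons a u b v : shuf (a :: u) (b :: v) =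
  [seq a :: w | w <- shuf u (b :: v)] ++ [seq b :: w | w <- shuf (a :: u) v].
Proof. by []. Qed.

Arguments shuf : simpl never.

Lemma shuf0r u : shuf u [::] = [:: u]. Proof. by case: u. Qed.

Lemma perm_shufC u v : perm_eq (shuf u v) (shuf v u).
Proof.
elim: u v => [|a u IHu] v; first by rewrite shuf0r.
elim: v => [|b v IHv] //; rewrite !shuf_cons perm_catC perm_cat ?perm_map //.
Qed.

Lemma size_shuf u v w : w \in shuf u v -> size w = (size u + size v)%N.
Proof.
elim: u v w => [|a u IHu] v w; first by rewrite inE => /eqP->.
elim: v w => [|b v IHv] w; first by rewrite inE => /eqP->; rewrite addn0.
rewrite shuf_cons mem_cat => /orP[] /mapP[w' w'P ->] /=.
  by rewrite (IHu _ _ w'P).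
by rewrite (IHv _ w'P) /= addnS.
Qed.

Lemma mem_shuf u v w : uniq (u ++ v) ->
  (w \in shuf u v) = [&& perm_eq w (u ++ v), subseq u w & subseq v w].
Proof.
have mem1 x y : (x \in [:: y]) = perm_eq x y && subseq y x.
  rewrite inE; apply/eqP/andP => [->|[/perm_size e sub]].
    by rewrite perm_refl subseq_refl.
  by apply/esym/eqP; rewrite -(size_subseq_leqif sub) e.
elim: w u v => [|c w IHw] [|a u] [|b v] uniq_uv; rewrite ?mem1 ?cats0 ?sub0seq ?andbT //.
- rewrite shuf_cons mem_cat andbF.
  by apply/negP => /orP[] /mapP[].
- rewrite shuf_cons mem_cat.
  have mem_map x L : (c :: w \in [seq x :: w' | w' <- L]) = (c == x) && (w \in L).
    apply/mapP/andP => [[w' w'L [-> ->]]//|[/eqP-> wL]]; by exists w.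
  have [eq_ca|ne_ca] := eqVneq c a.
    subst c; have ne_ab : (a == b) = false.
      move: uniq_uv; rewrite /= mem_cat inE; case: eqVneq => //= _.
      by rewrite orbT.
    rewrite !mem_map !eqxx ne_ab orbF /= perm_cons eqxx [b == a]eq_sym ne_ab.
    by rewrite IHw //; case/andP: uniq_uv.
  have [eq_cb|ne_cb] := eqVneq c b.
    subst c; have p := permEl (perm_catCA (a :: u) [:: b] v).
    rewrite perm_sym (permPl p) /= perm_cons perm_sym.
    rewrite !mem_map (negPf ne_ca) !eqxx [a == b]eq_sym (negPf ne_ca) /= IHw //.
    by move: uniq_uv; rewrite (perm_uniq p) => /andP[].
  (* If [c] is neither head, both words lie inside [w], which is one letter too short for the
     distinct letters of their concatenation. *)
  rewrite !mem_map (negPf ne_ca) (negPf ne_cb) /=; apply/esym/negP.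
  rewrite [a == c]eq_sym [b == c]eq_sym (negPf ne_ca) (negPf ne_cb).
  case/and3P => /perm_size/= [e] /mem_subseq sub_u /mem_subseq sub_v.
  have := uniq_leq_size uniq_uv; move=> /(_ w).
  rewrite /= -e ltnn => H; apply/notF/H => x.
  rewrite -[_ :: _]/((a :: u) ++ b :: v) mem_cat.
  by case/orP; [exact: sub_u | exact: sub_v].
Qed.

Lemma shuf_uniq u v : uniq (u ++ v) -> uniq (shuf u v).
Proof.
elim: u v => [|a u IHu] v //; elim: v => [|b v IHv] // uniq_uv.
rewrite shuf_cons cat_uniq !map_inj_uniq; try by move=> ? ? [].
rewrite IHu ?IHv /= ?andbT; first last.
- by case/andP: uniq_uv.
- move: uniq_uv.
  by rewrite (perm_uniq (permEl (perm_catCA (a :: u) [:: b] v))) /= => /andP[].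
apply/hasPn => w /mapP[w' _ ->]; apply/mapP => -[w'' _ [eq_ba _]].
by move: uniq_uv; rewrite eq_ba /= mem_cat inE eqxx orbT.
Qed.

(** * Descents and major index of reversed words *)

Definition descent_at a w := if w is b :: _ then (a < b)%O else false.

(* Descents and major index of the reversal of [w]. *)
Fixpoint rdes w : nat :=
  if w is a :: w' then (descent_at a w' + rdes w')%N else 0.

Fixpoint rmaj w : nat :=
  if w is a :: w' then (descent_at a w' * size w' + rmaj w')%N else 0.

(** Appending a letter keeps the earlier descents and adds at most the position [size w], the
    1-based index of the former last letter. *)
Lemma descents_rev_cons a w :
  descents (rev (a :: w)) = descents (rev w) ++ nseq (descent_at a w) (size w).
Proof.
case: w => [|b w] //; rewrite !rev_cons; set z := rev w.
rewrite /descents !size_rcons size_rev !succnK.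
have -> : iota 1 (size w).+1 = iota 1 (size w) ++ [:: (size w).+1].
  by rewrite -[in LHS](addn1 (size w)) iotaD add1n.
rewrite filter_cat.
congr (_ ++ _).
  apply: eq_in_filter => -[|i] //; rewrite mem_iota => lt_i.
  rewrite /is_descent !succnK -!cats1 !onth_cat !size_cat size_rev !addn1.
  have -> : (i < (size w).+1)%N by lia.
  have -> : (i.+1 < (size w).+1)%N by lia.
  by rewrite !succnK; congr (_ && _); lia.
have -> : size (b :: w) = (size w).+1 by [].
rewrite [filter _ _]/= /is_descent succnK -!cats1 !onth_cat !size_cat size_rev !addn1.
rewrite !ltnSn !ltnn !subnn.
by rewrite /=; case: ifP.
Qed.

Lemma rdesE w : des (rev w) = rdes w.
Proof.
elim: w => //= a w IH; rewrite /des descents_rev_cons size_cat size_nseq -IH.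
by rewrite addnC.
Qed.

Lemma rmajE w : maj (rev w) = rmaj w.
Proof.
elim: w => //= a w IH; rewrite /maj descents_rev_cons sumn_cat sumn_nseq -IH.
by rewrite addnC mulnC.
Qed.

Lemma rdes_cons_le a w : (rdes (a :: w) <= size w)%N.
Proof. by elim: w a => //= b w IH a; have /= := IH b; case: (a < b)%O; lia. Qed.

Lemma rdes_le w : (rdes w <= size w)%N.
Proof. by case: w => // a w; apply/leqW/rdes_cons_le. Qed.

(** * Generating functions by last letter *)

Definition majgf (k : nat) L : {poly int} :=
  \sum_(w <- L | rdes w == k) 'X^(rmaj w).

Lemma majgf_perm k L1 L2 : perm_eq L1 L2 -> majgf k L1 = majgf k L2.
Proof. exact: perm_big. Qed.

Lemma majgf_cat k L1 L2 : majgf k (L1 ++ L2) = majgf k L1 + majgf k L2.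
Proof. exact: big_cat. Qed.

Lemma majgf1 k w : majgf k [:: w] = if rdes w == k then 'X^(rmaj w) else 0.
Proof. by rewrite /majgf big_cons big_nil addr0. Qed.

Notation tail_gf c k L := (majgf k [seq c :: w | w <- L]).

Lemma tail_gf_asc c a k L : (a <= c)%O ->
  tail_gf c k [seq a :: w | w <- L] = tail_gf a k L.
Proof.
move=> le_ac; rewrite /majgf !big_map /=.
by apply: eq_big => w; rewrite ltNge le_ac.
Qed.

(** The new descent sits at position [p.+1], the same for all words since those of [L] share their
    length; hence the common factor. *)
Lemma tail_gf_desc c a k p L : (c < a)%O -> {in L, forall w, size w = p} ->
  tail_gf c k [seq a :: w | w <- L] =
  if k is k'.+1 then 'X^(p.+1) * tail_gf a k' L else 0.
Proof.
move=> lt_ca sizeL; rewrite /majgf !big_map /= lt_ca.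
case: k => [|k]; first by rewrite big_pred0.
rewrite big_map mulr_sumr !(big_seq_cond (fun w => _ == _)).
apply: eq_big => [w|w /andP[wL _]]; first by rewrite add1n eqSS.
by rewrite mul1n -exprD /= (sizeL w wL).
Qed.

Definition shuffle_gfE u v := forall k,
  majgf k (shuf u v) =
  gf (size u) (rdes u) (size v) (rdes v) (rmaj u + rmaj v) k.

(** Meant for [b < a]. By contrast [shuffle_gfE] compares no letters, so its two words may be
    exchanged. *)
Definition tail_gfE a u b v := forall k,
  tail_gf a k (shuf u (b :: v)) =
    gfA (size u) (rdes (a :: u)) (size v) (rdes (b :: v))
        (rmaj (a :: u) + rmaj (b :: v)) k /\
  tail_gf b k (shuf (a :: u) v) =
    gfB (size u) (rdes (a :: u)) (size v) (rdes (b :: v))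
        (rmaj (a :: u) + rmaj (b :: v)) k.

Lemma shuffle_gfE_sym u v : shuffle_gfE u v -> shuffle_gfE v u.
Proof.
by move=> uvE k; rewrite (majgf_perm _ (perm_shufC v u)) uvE gfC addnC.
Qed.

Lemma tail_to_shuffle_gfE a u b v :
  tail_gfE a u b v -> shuffle_gfE (a :: u) (b :: v).
Proof.
move=> tailE k; rewrite shuf_cons majgf_cat; have [-> ->] := tailE k.
by rewrite gf_split ?rdes_cons_le.
Qed.

Lemma shuffle_gfE0 v : shuffle_gfE [::] v.
Proof.
move=> k; rewrite majgf1 /gf /= add0n subn0 add0n addn0.
case: eqP => [<-|ne_k].
  by rewrite /qbinl leqnn subnn muln0 addn0 subn0 qbinn qbin0 !mulr1.
have [lt_k|le_k] := ltnP k (rdes v).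
  by rewrite [X in _ * X]qbinl_eq0 ?mulr0 //; lia.
by rewrite [X in _ * X * _]qbinl_eq0 ?mulr0 ?mul0r //; lia.
Qed.

Lemma tail_gfA_step a u b v k : (b < a)%O -> shuffle_gfE u (b :: v) ->
  (forall a' u', u = a' :: u' -> (b < a')%O -> tail_gfE a' u' b v) ->
  tail_gf a k (shuf u (b :: v)) =
    gfA (size u) (rdes (a :: u)) (size v) (rdes (b :: v))
        (rmaj (a :: u) + rmaj (b :: v)) k.
Proof.
have le_sv := rdes_cons_le b v.
move=> lt_ba uvE IH; have lt_ab : (a < b)%O = false by rewrite lt_gtF.
case: u uvE IH => [|a' u] uvE IH.
  rewrite gfA_asc //; have := uvE k; rewrite majgf1 => /= <-.
  by rewrite majgf1 /= lt_ab.
(* If the preceding letter [a'] exceeds [a], then also [b < a'], and the induction hypothesis gives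
   the two parts separately. *)
have [lt_aa'|le_a'a] := ltP a a'.
  have {IH} tailE := IH _ _ erefl (lt_trans lt_ba lt_aa').
  rewrite shuf_cons map_cat majgf_cat (tail_gf_asc _ _ (ltW lt_ba)) (proj2 (tailE k)).
  rewrite (tail_gf_desc _ lt_aa' (@size_shuf _ _)).
  rewrite [size (a' :: u)]/= [rdes (a :: _)]/= [rmaj (a :: _)]/=.
  rewrite lt_aa' add1n mul1n -addnA.
  rewrite gfA_desc ?rdes_cons_le //; congr (_ + _).
  by case: (k) => // k'; rewrite (proj1 (tailE k')) [size (b :: v)]/= addnS.
(* Neither [a'] nor [b] exceeds [a], so the two parts recombine into all shuffles of the shortened
   pair. *)
rewrite shuf_cons map_cat majgf_cat !tail_gf_asc ?(ltW lt_ba) //.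
rewrite -majgf_cat -shuf_cons uvE gfA_asc //=.
by rewrite ltNge le_a'a.
Qed.

Lemma tail_gfB_step a u b v k : (b < a)%O -> shuffle_gfE (a :: u) v ->
  (forall b' v', v = b' :: v' -> (b' < a)%O -> tail_gfE a u b' v') ->
  tail_gf b k (shuf (a :: u) v) =
    gfB (size u) (rdes (a :: u)) (size v) (rdes (b :: v))
        (rmaj (a :: u) + rmaj (b :: v)) k.
Proof.
have le_ru := rdes_cons_le a u.
move=> lt_ba uvE IH; case: v uvE IH => [|b' v] uvE IH.
  (* The only shuffle is the first word followed by [b], with a new descent at position
     [(size u).+1]. *)
  rewrite shuf0r majgf1.
  have -> : rdes [:: b, a & u] = (rdes (a :: u)).+1.
    by rewrite [LHS]/= lt_ba add1n.
  have -> : rmaj [:: b, a & u] = ((size u).+1 + rmaj (a :: u))%N.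
    by rewrite [LHS]/= lt_ba mul1n.
  rewrite /gfB.
  have -> : rdes [:: b] = 0 by []; have -> : rmaj [:: b] = 0 by [].
  move: (rdes _) (rmaj _) le_ru => r x le_ru.
  rewrite [size [::]]/= !(subn0, sub0n, addn0, add0n).
  case: eqP => [<-|ne_k].
    by rewrite subnn /qbinl !leqnn subnn subn0 qbin0 qbinn mul0n addn0 !mulr1 addnC.
  have [lt_k|le_k] := ltnP k r.+1.
    by rewrite qbinl_eq0 ?mulr0 ?mul0r //; lia.
  by rewrite [X in _ * X]qbinl_eq0 ?mulr0 //; lia.
have le_sv := rdes_cons_le b' v.
rewrite shuf_cons map_cat majgf_cat.
rewrite (tail_gf_desc _ lt_ba (@size_shuf _ _)).
(* When [b < b'], the letters [a] and [b'] may compare either way, so only the sum of the two parts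
   is used; otherwise [b' <= b < a] keeps the order. *)
have [lt_bb'|le_b'b] := ltP b b'.
  rewrite (tail_gf_desc _ lt_bb' (@size_shuf _ _)).
  rewrite [size (b' :: v)]/= [rdes (b :: _)]/= [rmaj (b :: _)]/= lt_bb' add1n mul1n.
  rewrite addnCA gfB_desc //; case: k => [|k]; first by rewrite addr0.
  by rewrite addnS addSn -mulrDr -majgf_cat -shuf_cons uvE.
have {IH} tailE := IH _ _ erefl (le_lt_trans le_b'b lt_ba).
rewrite tail_gf_asc // (proj2 (tailE k)).
rewrite [size (b' :: v)]/= [rdes (b :: _)]/= [rmaj (b :: _)]/= ltNge le_b'b mul0n !add0n.
rewrite gfB_asc //; congr (_ + _).
by case: (k) => // k'; rewrite (proj1 (tailE k')) addnS.
Qed.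

Lemma shuf_gf u v : (forall x, x \in u -> x \notin v) -> shuffle_gfE u v.
Proof.
(* The formulas by last letter need the full sum for shorter words, so both are carried through one
   induction on total length. *)
suff main N : forall u v, (size u + size v < N)%N ->
    (forall x, x \in u -> x \notin v) ->
  shuffle_gfE u v /\ forall a u' b v', u = a :: u' -> v = b :: v' -> (b < a)%O ->
  tail_gfE a u' b v'.
  by move=> disj; have [] := main _ u v (ltnSn _) disj.
elim: N => // N IH {}u {}v lt_N disj.
have tailE a u' b v' : (size u' + size v' + 2 <= N)%N ->
  (forall x, x \in a :: u' -> x \notin b :: v') -> (b < a)%O -> tail_gfE a u' b v'.
  move=> le_N disj' lt_ba k; split.
    apply: tail_gfA_step => //.
      have [] // := IH u' (b :: v'); first by rewrite /=; lia.
      by move=> x xu; apply: disj'; rewrite inE xu orbT.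
    move=> a' u'' eq_u' lt_ba'; subst u'.
    have [] := IH (a' :: u'') (b :: v'); first by move: le_N => /=; lia.
      by move=> x xu; apply: disj'; rewrite inE xu orbT.
    by move=> _; apply.
  apply: tail_gfB_step => //.
    have [] // := IH (a :: u') v'; first by rewrite /=; lia.
    by move=> x xu; have:= disj' x xu; rewrite inE negb_or => /andP[].
  move=> b' v'' eq_v' lt_b'a; subst v'.
  have [] := IH (a :: u') (b' :: v''); first by move: le_N => /=; lia.
    by move=> x xu; have:= disj' x xu; rewrite inE negb_or => /andP[].
  by move=> _; apply.
split; last first.
  move=> a u' b v' eu ev; subst u v; apply: tailE => //.
  by move: lt_N => /=; lia.
case: u lt_N disj => [|a u] lt_N disj; first exact: shuffle_gfE0.
case: v lt_N disj => [|b v] lt_N disj; first exact/shuffle_gfE_sym/shuffle_gfE0.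
(* The word with the larger last letter takes the first role; equality contradicts disjointness. *)
have [lt_ab|lt_ba|eq_ab] := ltgtP a b.
- apply/shuffle_gfE_sym/tail_to_shuffle_gfE/tailE => //.
    by move: lt_N => /=; lia.
  by move=> x xv; apply/negP => /disj; rewrite xv.
- apply/tail_to_shuffle_gfE/tailE => //.
  by move: lt_N => /=; lia.
by have := disj a; rewrite eq_ab !inE eqxx => /(_ isT).
Qed.

End Shuffles.

(** * Enumeration of bounded partitions *)

Fixpoint Plist (j t N : nat) : seq (seq int) :=
  if j is j'.+1 then
    [seq x%:Z :: la | x <- iota t (N.+1 - t), la <- Plist j' t x]
  else [:: [::]].

Fixpoint Plelist (j N : nat) : seq (seq int) :=
  if j is j'.+1 then
    [::] :: [seq x%:Z :: mu | x <- iota 1 N, mu <- Plelist j' x]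
  else [:: [::]].

Definition nweight (la : seq int) : nat := sumn (map absz la).

Lemma mem_cons_dep (s : seq nat) (t : nat -> seq (seq int)) y l :
  (y :: l \in [seq x%:Z :: la | x <- s, la <- t x]) =
  [&& 0 <= y, `|y|%N \in s & l \in t `|y|%N].
Proof.
apply/allpairsPdep/and3P => [[x [la [xs la_t [-> ->]]]]|[y_ge0 ys lt]]; first by [].
by exists `|y|%N, l; split; rewrite ?gez0_abs.
Qed.

Lemma nil_notin_cons_dep (s : seq nat) (t : nat -> seq (seq int)) :
  ([::] \in [seq x%:Z :: la | x <- s, la <- t x]) = false.
Proof. by apply/allpairsPdep => -[x [la [_ _]]]. Qed.

Lemma uniq_cons_dep (s : seq nat) (t : nat -> seq (seq int)) :
  uniq s -> (forall x, uniq (t x)) ->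
  uniq [seq x%:Z :: la | x <- s, la <- t x].
Proof.
move=> us ut; apply: (@allpairs_uniq_dep _ (fun=> seq int)) => //.
by move=> [x la] [y mu] _ _ /= [-> ->].
Qed.

Lemma uniq_Plist j t N : uniq (Plist j t N).
Proof. by elim: j N => //= j IH N; apply: uniq_cons_dep; rewrite ?iota_uniq. Qed.

Lemma uniq_Plelist j N : uniq (Plelist j N).
Proof.
elim: j N => //= j IH N.
by rewrite nil_notin_cons_dep uniq_cons_dep ?iota_uniq.
Qed.

Lemma mem_Plist j t N la : (la \in Plist j t N) =
  [&& size la == j, path >=%R N%:Z la & all (fun x => t%:Z <= x) la].
Proof.
elim: j N la => [|j IH] N [|y la] //=; first by rewrite nil_notin_cons_dep.
rewrite mem_cons_dep eqSS mem_iota IH.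
case: y => y; last by rewrite !andbF.
rewrite absz_nat /= !lez_nat.
have -> : (t <= y < t + (N.+1 - t))%N = (y <= N)%N && (t <= y)%N by lia.
by case: (y <= N)%N (t <= y)%N (size la == j) => [] [] [] //=; rewrite ?andbF.
Qed.

Lemma mem_Plelist j N mu : (mu \in Plelist j N) =
  [&& (size mu <= j)%N, path >=%R N%:Z mu & all (fun x => 0 < x) mu].
Proof.
elim: j N mu => [|j IH] N [|y mu] //=.
rewrite in_cons /= mem_cons_dep ltnS mem_iota IH.
case: y => y; last by rewrite !andbF.
rewrite absz_nat /= !lez_nat ltz_nat.
have -> : (1 <= y < 1 + N)%N = (y <= N)%N && (0 < y)%N by lia.
by case: (y <= N)%N (0 < y)%N (size mu <= j)%N => [] [] [] //=; rewrite ?andbF.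
Qed.

Lemma le_last_path (t x : int) la : path >=%R x la ->
  (t <= last x la) = (t <= x) && all (fun y => t <= y) la.
Proof.
elim: la x => [|y la IH] x /=; first by rewrite andbT.
case/andP => le_yx /IH->; case: (leP t y) => [/le_trans->//|_].
by rewrite andbF.
Qed.

Lemma in_P_ge0 (j t N : int) la : in_P j t N la -> all (fun x => 0 <= x) la.
Proof.
case/and5P => _ t_ge0 _ _ /and3P[srt _].
case: la srt => //= x la srt; rewrite le_last_path // -[_ && _]/(all _ (x :: la)).
by apply: sub_all => y; apply: le_trans.
Qed.

Lemma in_Ple_ge0 (j N : int) mu : in_Ple j N mu -> all (fun x => 0 <= x) mu.
Proof.
by case/and4P => _ _ /andP[_ mu_gt0] _; apply: sub_all mu_gt0 => y /ltW.
Qed.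

Lemma in_PE (j t N : nat) la : in_P j%:Z t%:Z N%:Z la = (la \in Plist j t N).
Proof.
rewrite mem_Plist /in_P !lez_nat /= eqz_nat; congr (_ && _).
(* On the empty sequence the defaults [N] and [t] meet the two bounds. *)
case: la => [|x la] /=; first by rewrite !lexx.
rewrite andbCA -andbA; congr (_ && _).
by case: (boolP (path >=%R x la)) => // /le_last_path->.
Qed.

Lemma in_PleE (j N : nat) mu : in_Ple j%:Z N%:Z mu = (mu \in Plelist j N).
Proof.
rewrite mem_Plelist /in_Ple /is_partition !lez_nat /=.
case: mu => [|x mu] //=.
case: (size mu < j)%N => /=; last by rewrite andbF.
by rewrite andbC andbA.
Qed.

Lemma sum_cons_dep (s : seq nat) (t : nat -> seq (seq int)) :
  \sum_(la <- [seq x%:Z :: la | x <- s, la <- t x]) 'X^(nweight la) =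
  \sum_(x <- s) 'X^x * \sum_(la <- t x) 'X^(nweight la) :> {poly int}.
Proof.
rewrite big_allpairs_dep; apply: eq_bigr => x _; rewrite mulr_sumr.
by apply: eq_bigr => la _; rewrite -exprD.
Qed.

Lemma iota_rcons m n : iota m n.+1 = iota m n ++ [:: (m + n)%N].
Proof. by rewrite -[in LHS](addn1 n) iotaD. Qed.

(** For length $j+1$, group by the first entry: admitting the value $t+N+1$ adds $q^{t+N+1} q^{jt}
    [N+1+j, j]$, which is $q^{(j+1)t}$ times the increment in [qbin_rec]. *)
Lemma Plist_gf j t N :
  \sum_(la <- Plist j t (t + N)) 'X^(nweight la) = 'X^(j * t) * qbin (N + j) j.
Proof.
elim: j N => [|j IH] N; first by rewrite big_seq1 qbin0 mulr1.
rewrite [Plist _ _ _]/= sum_cons_dep.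
have -> : ((t + N).+1 - t = N.+1)%N by lia.
elim: N => [|N IHN].
  by have := IH 0; rewrite !addn0 big_seq1 => ->; rewrite !add0n !qbinn !mulr1 -exprD.
rewrite iota_rcons big_cat IHN big_seq1 IH -addSnnS [in RHS]addnS.
rewrite [in RHS]qbin_rec [RHS]mulrDr.
by apply: (congr2 +%R) => //; rewrite !mulrA -!exprD; congr ('X^_ * _); lia.
Qed.

Lemma Plist_gt j t N : (0 < j)%N -> (N < t)%N -> Plist j t N = [::].
Proof. by case: j => //= j _ lt_Nt; have -> : (N.+1 - t = 0)%N by lia. Qed.

(** Group by the largest part; the lower index is now [N], so the recurrence is [qbinS]. *)
Lemma Plelist_gf j N :
  \sum_(mu <- Plelist j N) 'X^(nweight mu) = qbin (N + j) N.
Proof.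
elim: j N => [|j IH] N; first by rewrite big_seq1 addn0 qbinn.
rewrite [Plelist _ _]/= big_cons sum_cons_dep.
elim: N => [|N IHN]; first by rewrite big_nil qbin0 addr0.
rewrite iota_rcons big_cat big_seq1 IH addrA IHN add1n -addSnnS.
by rewrite [in RHS]addnS [in RHS]qbinS [RHS]addrC.
Qed.

Lemma weightE la : all (fun x => 0 <= x) la -> weight la = (nweight la)%:Z.
Proof.
rewrite /weight /nweight; elim: la => [|x la IH] /=; first by rewrite big_nil.
by case/andP => x_ge0 /IH; rewrite big_cons PoszD gez0_abs // => ->.
Qed.

(** * From equal generating functions to a bijection *)

(** The coefficient of $q^i$ is the multiplicity of $i$. *)
Lemma perm_of_gf (s1 s2 : seq nat) :
  \sum_(i <- s1) 'X^i = \sum_(i <- s2) 'X^i :> {poly int} -> perm_eq s1 s2.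
Proof.
have coefE (s : seq nat) i :
    (\sum_(j <- s) 'X^j : {poly int})`_i = (count_mem i s)%:R.
  elim: s => [|j s IH]; first by rewrite big_nil coef0.
  by rewrite big_cons coefD IH coefXn /= natrD eq_sym.
move=> eq12; apply/allP => i _; apply/eqP.
have := congr1 (fun p : {poly int} => p`_i) eq12.
by rewrite /= !coefE => /eqP; rewrite eqr_nat => /eqP.
Qed.

(** A permutation of positions aligning the two lists of values matches the elements at
    corresponding positions. *)
Lemma perm_map_bij (A B C : eqType) (f : A -> C) (g : B -> C)
    (x0 : A) (y0 : B) (s1 : seq A) (s2 : seq B) :
  uniq s1 -> uniq s2 -> perm_eq (map f s1) (map g s2) ->
  exists phi psi,
    [/\ {in s1, forall x, phi x \in s2}, {in s1, forall x, g (phi x) = f x},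
        {in s2, forall y, psi y \in s1}, {in s1, cancel phi psi} &
        {in s2, cancel psi phi}].
Proof.
move=> us1 us2 /(perm_iotaP (f x0)); rewrite size_map => -[Is pI eqI].
have sizeI : size Is = size s2 by rewrite (perm_size pI) size_iota.
have size12 : size s1 = size s2 by rewrite -sizeI -(size_map f) eqI size_map.
have uI : uniq Is by rewrite (perm_uniq pI) iota_uniq.
have memI i : (i \in Is) = (i < size s2)%N by rewrite (perm_mem pI) mem_iota.
have ltI x : x \in s1 -> (nth 0%N Is (index x s1) < size s2)%N.
  by move=> xs; rewrite -memI mem_nth // sizeI -size12 index_mem.
have ltS y : y \in s2 -> (index (index y s2) Is < size s1)%N.
  by move=> ys; rewrite size12 -sizeI index_mem memI index_mem.
exists (fun x => nth y0 s2 (nth 0%N Is (index x s1))).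
exists (fun y => nth x0 s1 (index (index y s2) Is)); split.
- by move=> x xs; rewrite mem_nth ?ltI.
- move=> x xs; rewrite -(nth_map _ (f x0)) ?ltI //.
  rewrite -(nth_map _ (f x0)) ?sizeI -?size12 ?index_mem // -eqI.
  by rewrite (nth_map x0) ?index_mem // nth_index.
- by move=> y ys; rewrite mem_nth ?ltS.
- move=> x xs /=; rewrite index_uniq ?ltI // index_uniq ?nth_index //.
  by rewrite sizeI -size12 index_mem.
- move=> y ys /=; rewrite index_uniq ?ltS // nth_index ?nth_index //.
  by rewrite memI index_mem.
Qed.

Theorem theorem3p1 (d : Order.disp_t) (T : orderType d)
    (m n r s k : nat) (sigma pi : seq T)
    (sigma_perm : uniq sigma) (pi_perm : uniq pi)
    (sigma_size : size sigma = m) (pi_size : size pi = n)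
    (sigma_des : des sigma = r) (pi_des : des pi = s)
    (disj : forall x : T, x \in sigma -> x \notin pi) :
  exists Phi : shuffle_des k sigma pi ->
      P (k%:Z - r%:Z) (k%:Z - s%:Z) m%:Z *
      Ple (n%:Z - k%:Z + r%:Z) (k%:Z - s%:Z),
    bijective Phi /\
    forall alpha : shuffle_des k sigma pi,
      (maj (val alpha))%:Z =
        weight (val (Phi alpha).1) + weight (val (Phi alpha).2) +
        (maj sigma)%:Z + (maj pi)%:Z.
Proof.
have uniq_sp : uniq (rev sigma ++ rev pi).
  rewrite cat_uniq !rev_uniq sigma_perm pi_perm andbT /=.
  by apply/hasPn => x; rewrite !mem_rev => xpi; apply/negP => /disj; rewrite xpi.
have disj_rev x : x \in rev sigma -> x \notin rev pi by rewrite !mem_rev; apply: disj.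
pose E1 := [seq rev w | w <- shuf (rev sigma) (rev pi) & rdes w == k].
have uE1 : uniq E1.
  by rewrite map_inj_uniq ?filter_uniq ?shuf_uniq //; apply: can_inj revK.
have memE1 alpha : (alpha \in E1) = is_shuffle sigma pi alpha && (des alpha == k).
  rewrite -[alpha]revK mem_map; last exact: can_inj revK.
  move: (rev alpha) => w; rewrite mem_filter mem_shuf // andbC rdesE; congr (_ && _).
  rewrite /is_shuffle -(subseq_rev sigma) -(subseq_rev pi) !revK size_rev rev_uniq.
  rewrite andbA; case: (boolP (subseq (rev sigma) w)) => [sub1|]; last by rewrite !andbF.
  case: (boolP (subseq (rev pi) w)) => [sub2|]; last by rewrite !andbF.
  rewrite !andbT.
  apply/idP/andP => [pw|[uw /eqP sw]].
    by rewrite (perm_uniq pw) (perm_size pw) size_cat !size_rev.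
  have sub x : x \in rev sigma ++ rev pi -> x \in w.
    by rewrite mem_cat => /orP[]; apply: mem_subseq.
  have [|_ eqi] := uniq_min_size uniq_sp sub.
    by rewrite size_cat !size_rev sw.
  by rewrite perm_sym uniq_perm.
(* The guard is needed because truncated subtraction would replace a negative parameter by 0, where
   the convention asks for the empty set. *)
pose E2 := if [&& r <= k, s <= k & k <= n + r]%N
  then [seq (la, mu) | la <- Plist (k - r) (k - s) m, mu <- Plelist (n + r - k) (k - s)]
  else [::].
have uE2 : uniq E2.
  rewrite /E2; case: ifP => // _; apply: allpairs_uniq.
  - exact: uniq_Plist.
  - exact: uniq_Plelist.
  by move=> [? ?] [? ?] _ _ [-> ->].
have memE2 y : (y \in E2) = in_P (k%:Z - r%:Z) (k%:Z - s%:Z) m%:Z y.1 &&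
                           in_Ple (n%:Z - k%:Z + r%:Z) (k%:Z - s%:Z) y.2.
  rewrite /E2; case: ifP => [/and3P[le_rk le_sk le_kn]|/negP H]; last first.
    apply/esym/negP => /andP[/and3P[j_ge0 t_ge0 _] /and3P[j'_ge0 _ _]].
    by apply: H; apply/and3P; split; lia.
  have -> : k%:Z - r%:Z = (k - r)%:Z by lia.
  have -> : k%:Z - s%:Z = (k - s)%:Z by lia.
  have -> : n%:Z - k%:Z + r%:Z = (n + r - k)%:Z by lia.
  rewrite in_PE in_PleE; case: y => la mu; apply/allpairsP/andP.
    by case=> -[la' mu'] [? ? [-> ->]].
  by case=> ? ?; exists (la, mu).
pose wt (y : seq int * seq int) := (nweight y.1 + nweight y.2 + (maj sigma + maj pi))%N.
have permE : perm_eq (map (@maj _ T) E1) (map wt E2).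
  apply: perm_of_gf; rewrite /E1 -map_comp !big_map big_filter.
  under eq_bigr => w _ do rewrite /= rmajE.
  rewrite -/(majgf k _) (shuf_gf disj_rev).
  rewrite -!rdesE -!rmajE !revK !size_rev sigma_size pi_size sigma_des pi_des.
  have le_rm : (r <= m)%N.
    by rewrite -sigma_des -sigma_size -[sigma]revK rdesE size_rev rdes_le.
  have le_sn : (s <= n)%N.
    by rewrite -pi_des -pi_size -[pi]revK rdesE size_rev rdes_le.
  rewrite /gf /E2; case: ifP => [/and3P[le_rk le_sk le_kn]|/negP H]; last first.
    (* If [k < r] the first binomial vanishes; otherwise [k < s] or [n + r < k], and the second one
       does. *)
    rewrite big_nil; have [lt_kr|le_rk] := ltnP k r.
      by rewrite [X in _ * X * _]qbinl_eq0 ?mulr0 ?mul0r //; lia.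
    by rewrite [X in _ * X]qbinl_eq0 ?mulr0 //; lia.
  have splitE : \sum_(y <- [seq (la, mu) | la <- Plist (k - r) (k - s) m,
                                          mu <- Plelist (n + r - k) (k - s)]) 'X^(wt y) =
      'X^(maj sigma + maj pi) *
      ((\sum_(la <- Plist (k - r) (k - s) m) 'X^(nweight la)) *
       \sum_(mu <- Plelist (n + r - k) (k - s)) 'X^(nweight mu)) :> {poly int}.
    rewrite big_allpairs mulr_suml mulr_sumr; apply: eq_bigr => la _.
    by rewrite !mulr_sumr; apply: eq_bigr => mu _; rewrite -!exprD addnC.
  rewrite {}splitE Plelist_gf.
  (* If [m < k - s], then [0 < k - r] because [r <= m], so no sequence fits the bounds; the first
     binomial vanishes as well. *)
  have [le_tm|lt_mt] := leqP (k - s) m; last first.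
    rewrite Plist_gt ?big_nil //; last lia.
    by rewrite [qbinl _ k r]qbinl_eq0 ?(mulr0, mul0r) ?mulr0 //; lia.
  (* This is the form [t + N] of [Plist_gf]. The upper indices become $(m-(k-s))+(k-r) = m-r+s$ and
     $(k-s)+(n+r-k) = n-s+r$, as in [gf]. *)
  have {2}-> : (m = (k - s) + (m - (k - s)))%N by lia.
  rewrite Plist_gf /qbinl le_rk le_sk exprD -!mulrA.
  by congr (_ * (_ * (qbin _ _ * qbin _ _))); lia.
have [phi [psi [phiP wt_phi psiP phiK psiK]]] :=
  perm_map_bij [::] ([::], [::]) uE1 uE2 permE.
have valE1 (x : shuffle_des k sigma pi) : val x \in E1 by rewrite memE1 (valP x).
have phi1 (x : shuffle_des k sigma pi) :
    in_P (k%:Z - r%:Z) (k%:Z - s%:Z) m%:Z (phi (val x)).1.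
  by have := phiP _ (valE1 x); rewrite memE2 => /andP[].
have phi2 (x : shuffle_des k sigma pi) :
    in_Ple (n%:Z - k%:Z + r%:Z) (k%:Z - s%:Z) (phi (val x)).2.
  by have := phiP _ (valE1 x); rewrite memE2 => /andP[].
pose U := (P (k%:Z - r%:Z) (k%:Z - s%:Z) m%:Z *
           Ple (n%:Z - k%:Z + r%:Z) (k%:Z - s%:Z))%type.
pose Phi x : U :=
  (exist (fun la => in_P _ _ _ la) _ (phi1 x),
   exist (fun mu => in_Ple _ _ mu) _ (phi2 x)).
have valE2 (y : U) : (val y.1, val y.2) \in E2.
  by rewrite memE2 (valP y.1) (valP y.2).
have psi1 (y : U) : is_shuffle sigma pi (psi (val y.1, val y.2)) &&
                    (des (psi (val y.1, val y.2)) == k).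
  by rewrite -memE1; apply: psiP.
exists Phi; split.
  exists (fun y => exist (fun alpha => is_shuffle sigma pi alpha && (des alpha == k))
                         _ (psi1 y)).
    by move=> x; apply: val_inj; rewrite /= -surjective_pairing phiK ?valE1.
  case=> la mu; congr (_, _); apply: val_inj => /=.
    by rewrite (psiK _ (valE2 (la, mu))).
  by rewrite (psiK _ (valE2 (la, mu))).
move=> x; have := wt_phi _ (valE1 x); rewrite /wt => <-.
by rewrite (weightE (in_P_ge0 (phi1 x))) (weightE (in_Ple_ge0 (phi2 x))) !PoszD !addrA.
Qed.
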